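(* The family of Borel null-finite subsets of $\mathbb{R}$ is not an ideal.
   Context: A subset $A$ of an abelian Polish group $X$ is null-finite if there is a convergent sequence $(x_n)_{n\in\omega}\subseteq X$ such that $\{n\in\omega:\ x_n-x\in A\}$ is finite for all $x\in X$, where $\omega=\{0,1,2,\ldots\}$. Here $X=\mathbb{R}$ with addition. A collection of subsets of a set $X$ is called an ideal on $X$ if it is closed under taking subsets and finite unions. *)

(* Defs.v *)
From mathcomp Require Import all_boot all_order all_algebra.
From mathcomp Require Import all_classical all_reals all_analysis.
Set Implicit Arguments.
Unset Strict Implicit.
Unset Printing Implicit Defensive.
Import numFieldNormedType.Exports.
Local Open Scope classical_set_scope.
Local Open Scope ring_scope.

(* Polishness of X plays no role in the definition itself. The set below
   collects indices, so repeated terms of u are counted separately. *)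
Definition null_finite (X : topologicalZmodType) (A : set X) : Prop :=
  exists u : nat -> X,
    (exists l : X, u @ \oo --> l) /\
    forall x : X, finite_set [set n | A (u n - x)].

Definition borel (X : topologicalType) : set (set X) := <<s @open X >>.

Definition borel_null_finite (X : topologicalZmodType) : set (set X) :=
  [set A | borel A /\ null_finite A].

Definition is_ideal (X : Type) (I : set (set X)) : Prop :=
  (forall A B : set X, B `<=` A -> I A -> I B) /\ fin_bigcup_closed I.

(* Ideals of the family S: only subsets lying in S are required to stay in I.
   A family of Borel sets with an uncountable member never satisfies
   [is_ideal], because that member has non-Borel subsets; with S the Borel
   sets, this version does not see that obstruction. For I `<=` S,
   [is_ideal I] implies [is_ideal_of S I]. *)
Definition is_ideal_of (X : Type) (S I : set (set X)) : Prop :=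
  [/\ I `<=` S,
      (forall A B : set X, B `<=` A -> S B -> I A -> I B) &
      fin_bigcup_closed I].

(* Main.v *)
(* At a level [a], let the node of
   y in [0, 1) be the integer part of 2^a y; each node owns one private binary
   position (the code) between [a] and [base a], and y is coded at [a] when its
   digit at the later position [top a] equals its code digit. Fix a fast
   increasing sequence of levels and let S be the set of reals coded at all of
   them.
   S is null-finite: translating by 2^-(top a) flips the digit at [top a] without
   changing node and code, so every translate of the sequence of these numbers
   meets S at most once.
   On the other hand, let w_n be a null sequence, infinitely many terms of which
   have size roughly between 2^-(top a) and 2^-a', for consecutive levels a < a'. Then
   some x + w_n are in S for infinitely many n: at a given level, the relevant
   points x + w_n lie in distinct nodes, so their code digits can be prescribed
   independently and matched with whatever their digits at [top a] turn out to
   be. The levels of even and of odd index of one sequence give two such sets,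
   and every nonzero null sequence is good for one of them, so that their union
   is not null-finite. *)
Require Import Defs.
From mathcomp Require Import all_boot all_order all_algebra.
From mathcomp Require Import all_classical all_reals all_analysis.
From mathcomp Require Import zify ring lra.
Import numFieldNormedType.Exports.
Import Order.TTheory GRing.Theory Num.Theory.
Set Implicit Arguments.
Unset Strict Implicit.
Unset Printing Implicit Defensive.
Local Open Scope classical_set_scope.
Local Open Scope ring_scope.

(** * Dyadic floors of real numbers *)

Section Construction.
Context {R : realType}.
Implicit Types (x y w u t : R) (p q h g a : nat).

Definition eps h : R := 2 ^- h.

Definition dfloor p x : int := Num.floor (2 ^+ p * x).

Lemma eps_gt0 h : 0 < eps h.
Proof. by rewrite /eps invr_gt0 exprn_gt0. Qed.

Lemma epsS h : eps h = 2 * eps h.+1.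
Proof. by rewrite /eps exprS invfM mulrA divff ?mul1r. Qed.

Lemma le_eps p q : (p <= q)%N -> eps q <= eps p.
Proof.
by move=> pq; rewrite /eps lef_pV2 ?posrE ?exprn_gt0// ler_eXn2l// ltr1n.
Qed.

Lemma lt_eps p q : (p < q)%N -> 2 * eps q <= eps p.
Proof. by move=> pq; rewrite (epsS p) ler_pM2l// le_eps. Qed.

Lemma dfloorP p x m :
  (dfloor p x == m) = (m%:~R * eps p <= x < (m + 1)%:~R * eps p).
Proof.
rewrite /dfloor floor_eq /eps ler_pdivrMr ?exprn_gt0// ltr_pdivlMr ?exprn_gt0//.
by rewrite (mulrC x).
Qed.

Lemma dfloor_itv p x :
  (dfloor p x)%:~R * eps p <= x < (dfloor p x)%:~R * eps p + eps p.
Proof.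
by have := eqxx (dfloor p x); rewrite {1}dfloorP intrD mulrDl mul1r.
Qed.

Lemma dfloor_eq p x m :
  m%:~R * eps p <= x < m%:~R * eps p + eps p -> dfloor p x = m.
Proof. by move=> H; apply/eqP; rewrite dfloorP intrD mulrDl mul1r. Qed.

Lemma dfloor_coarsen p q x y : (q <= p)%N ->
  dfloor p x = dfloor p y -> dfloor q x = dfloor q y.
Proof.
move=> qp; wlog suff le : x y / dfloor p x = dfloor p y -> dfloor q x <= dfloor q y.
  by move=> E; apply/eqP; rewrite eq_le !le.
move=> E; rewrite /dfloor floor_ge_int.
have pq (z : R) : 2 ^+ p * z = 2 ^+ (p - q) * (2 ^+ q * z).
  by rewrite mulrA -exprD subnK.
have : (2 ^+ (p - q) * dfloor q x <= dfloor p x)%R.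
  rewrite /dfloor floor_ge_int intrM rmorphXn/= pq.
  by rewrite ler_pM2l ?exprn_gt0// floor_le.
rewrite E {2}/dfloor floor_ge_int intrM rmorphXn/= pq.
by rewrite ler_pM2l ?exprn_gt0.
Qed.

Lemma dfloor_addz p q x (m : int) : (q <= p)%N ->
  dfloor p (x + m%:~R * eps q) = dfloor p x + 2 ^+ (p - q) * m.
Proof.
move=> qp; rewrite /dfloor mulrDr.
have -> : 2 ^+ p * (m%:~R * eps q) = (2 ^+ (p - q) * m)%:~R.
  rewrite intrM rmorphXn/= -(subnK qp) exprD addnK /eps.
  by field; rewrite expf_neq0.
by rewrite floorDrz ?intr_int// intrKfloor.
Qed.

Lemma dfloor_addeps p x : dfloor p (x + eps p) = dfloor p x + 1.
Proof. by have := dfloor_addz x 1 (leqnn p); rewrite subnn expr0 !mul1r. Qed.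

Lemma dfloor_dist p x y : dfloor p x = dfloor p y -> `|x - y| < eps p.
Proof.
move=> E; have := dfloor_itv p x; have := dfloor_itv p y; rewrite E ltr_norml.
move: (_ * _) => r; lra.
Qed.

(* An interval no longer than the mesh contains at most one grid point, and
   one of its two halves has none in its interior. *)
Lemma dfloor_const1 p h u w : (p <= h)%N ->
  exists t, [/\ u <= t, t + eps h.+1 <= u + eps h &
    forall x y, t <= x < t + eps h.+1 -> t <= y < t + eps h.+1 ->
      dfloor p (x + w) = dfloor p (y + w)].
Proof.
move=> ph; pose m := dfloor p (u + w).
have /andP[ul ur] := dfloor_itv p (u + w).
rewrite -/m in ul ur; have eh := epsS h; have pe := le_eps ph.
have e0 := eps_gt0 h.+1; have e1 := eps_gt0 p.
have E n z : n%:~R * eps p <= z < n%:~R * eps p + eps p -> dfloor p z = n.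
  exact: dfloor_eq.
have [c|c] := leP (u + eps h.+1) (m%:~R * eps p + eps p - w).
  exists u; split; [lra|lra|move=> x y hx hy].
  by transitivity m; [|symmetry]; apply: E; move: (_ * _) ul ur c => r *; lra.
exists (u + eps h.+1); split; [lra|lra|move=> x y hx hy].
by transitivity (m + 1); [|symmetry]; apply: E; rewrite intrD mulrDl mul1r;
  move: (_ * eps p) ul ur c => r *; lra.
Qed.

(** Each shift costs one halving; bounding their number by [n] fixes the final length in advance. *)
Lemma dfloor_const p h u (ws : seq R) n : (p <= h)%N -> (size ws <= n)%N ->
  exists t, [/\ u <= t, t + eps (h + n) <= u + eps h &
    forall w x y, w \in ws ->
      t <= x < t + eps (h + n) -> t <= y < t + eps (h + n) ->
      dfloor p (x + w) = dfloor p (y + w)].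
Proof.
elim: n ws h u => [|n IH] [|w ws] h u ph //= sn.
- by exists u; rewrite addn0.
- by exists u; split => //; rewrite lerD2l le_eps ?leq_addr.
have [t1 [ut1 t1u P1]] := dfloor_const1 u w ph.
have [t [ut tu P]] := IH ws h.+1 t1 (leqW ph) sn.
rewrite addSnnS in tu P; exists t; split; [lra|lra|].
move=> v x y; rewrite inE => /predU1P[->|vw] hx hy; last exact: P.
by apply: P1; lra.
Qed.

(** The two cells of mesh [eps p] after the one containing [u + w] still fit into the interval, and
    their indices have opposite parities. *)
Lemma dfloor_parity p g u w (r : int) : (g + 2 <= p)%N ->
  exists t, [/\ u <= t, t + eps p <= u + eps g &
    forall x, t <= x < t + eps p -> (2 %| r - dfloor p (x + w))%Z].
Proof.
move=> gp; pose m := dfloor p (u + w).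
have /andP[ul ur] := dfloor_itv p (u + w).
rewrite -/m in ul ur; have e1 := eps_gt0 p.
have := le_eps gp; rewrite addn2 => eg; have := epsS g; have := epsS g.+1 => *.
have [n [nl nr nd]] : exists n, [/\ m + 1 <= n, n <= m + 2 & (2 %| r - n)%Z].
  have [d|d] := boolP (2 %| r - (m + 1))%Z; first by exists (m + 1); split=> //; lia.
  by exists (m + 2); split; lia.
have nl' : m%:~R * eps p + eps p <= n%:~R * eps p.
  by rewrite -{2}(mul1r (eps p)) -mulrDl ler_pM2r// -(intrD _ m 1) ler_int.
have nr' : n%:~R * eps p <= m%:~R * eps p + 2 * eps p.
  by rewrite -mulrDl ler_pM2r// -(intrD _ m 2) ler_int.
exists (n%:~R * eps p - w).
move: (m%:~R * _) (n%:~R * eps p) (@dfloor_eq p ^~ n) ul ur nl' nr' => M N E *.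
split; [lra|lra|move=> x hx].
by rewrite E//; lra.
Qed.

Lemma dfloor_codes g u (w : nat -> R) (r : nat -> int) n :
  exists t, [/\ u <= t, t + eps (g + 2 * n) <= u + eps g &
    forall x j, t <= x < t + eps (g + 2 * n) -> (j < n)%N ->
      (2 %| r j - dfloor (g + 2 * j.+1) (x + w j))%Z].
Proof.
elim: n => [|n [t [ut tu P]]]; first by exists u; rewrite muln0 addn0.
have [|t' [tt' t't P']] :=
  @dfloor_parity (g + 2 * n.+1) (g + 2 * n) t (w n) (r n); first by lia.
have e0 := eps_gt0 (g + 2 * n.+1).
exists t'; split; [lra|lra|move=> x j hx].
by rewrite ltnS leq_eqVlt => /predU1P[->|jn]; [apply: P'|apply: P => //; lra].
Qed.

(** * Coding of reals at one level *)

(* Node [j] has its code digit at position [2 * a + 2 * j.+1 < base a]. The last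
   condition says that subtracting [2^-(top a)] borrows nothing from the digits
   up to [base a]. *)
Definition base a : nat := 2 * a + 2 * 2 ^ a + 1.
Definition top a : nat := base a + a + 1.

Lemma lt_top a : (a < top a)%N.
Proof. by rewrite /top /base; lia. Qed.

Lemma leq_top a b : (a <= b)%N -> (top a <= top b)%N.
Proof.
by move=> ab; have := @leq_pexp2l 2 a b isT ab; rewrite /top /base; lia.
Qed.

Definition coded a : set R := [set y | exists j, [/\ (j < 2 ^ a)%N,
  dfloor a y = j,
  (2 %| dfloor (top a) y - dfloor (2 * a + 2 * j.+1) y)%Z &
  dfloor (base a) (y - eps (top a)) = dfloor (base a) y]].

(* The interval of length [eps (base a)] found first fixes the digits at [top a],
   which are unaffected by multiples of [eps (base a)]; the codes are then chosen
   to match, and the interval is moved there by such a multiple. *)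
Lemma coded_translates a u (ws : seq R) : (size ws <= a)%N ->
  {in ws &, forall v w, v != w -> eps a <= `|v - w|} ->
  (forall x w, u <= x < u + eps a -> w \in ws -> 0 <= x + w < 1) ->
  exists t, [/\ u <= t, t + eps (top a + a) <= u + eps a &
    forall x w, t <= x < t + eps (top a + a) -> w \in ws -> coded a (x + w)].
Proof.
move=> sa sep bnd.
have [t0 [t0l t0u P0]] := dfloor_const 0 (leqnn (base a)) sa.
(* Starting at [t0 + eps (top a)] keeps both [x] and [x - eps (top a)] in the interval at [t0], of
   length [2 * eps (top a)]. *)
have [t1 [t1l t1u P1]] :=
  dfloor_const (t0 + eps (top a)) (leqnn (top a)) sa.
have [t2 [t2l t2u P2]] := dfloor_const u (leqnn a) sa.
(* The shift that lands in node [j]; for an empty node the default 0 only adds a harmless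
   condition. *)
pose wj j := nth 0 ws (find (fun w => dfloor a (t2 + w) == j%:Z) ws).
have [t3 [t3l t3u P3]] := dfloor_codes (2 * a) t2 wj
  (fun j => dfloor (top a) (t1 + wj j)) (2 ^ a).
have et : eps (base a + a) = 2 * eps (top a) by rewrite epsS /top addn1.
have eb : eps (2 * a + 2 * 2 ^ a) = 2 * eps (base a) by rewrite epsS /base addn1.
have bt : (base a <= top a)%N by rewrite /top; lia.
have eba := le_eps (leq_addr a (base a)).
have e0 := eps_gt0 (top a + a); have e1 := eps_gt0 (top a).
(* Moving by the first grid point beyond [t3] lands to the right of [t3], within the length
   [2 * eps (base a)] that the codes leave. *)
pose m := dfloor (base a) t3 + 1.
have /andP[ml mr] := dfloor_itv (base a) t3.
have mE : m%:~R * eps (base a) = (dfloor (base a) t3)%:~R * eps (base a) + eps (base a).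
  by rewrite intrD mulrDl mul1r.
have shift p y : (base a <= p)%N -> dfloor p y =
    dfloor p (y - m%:~R * eps (base a)) + 2 ^+ (p - base a) * m.
  by move=> bp; rewrite -dfloor_addz// subrK.
rewrite addnn -mul2n in t2u P2.
exists (t1 + m%:~R * eps (base a)).
move: (m%:~R * eps (base a)) ((dfloor (base a) t3)%:~R * eps (base a)) => M M'
  in mE ml mr shift *.
split=> [||x w xt ww]; [lra|lra|].
have ux : u <= x < u + eps a by lra.
have x2 : t2 <= x < t2 + eps (2 * a) by lra.
have t22 : t2 <= t2 < t2 + eps (2 * a) by rewrite lexx ltrDl eps_gt0.
have /andP[lo hi] := bnd _ _ ux ww.
have [j jE] : exists j : nat, dfloor a (x + w) = j.
  exists `|dfloor a (x + w)|%N; rewrite gez0_abs// /dfloor floor_ge0.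
  by rewrite mulr_ge0// exprn_ge0.
have jlt : (j < 2 ^ a)%N.
  rewrite -ltz_nat -jE /dfloor floor_lt_int -pmulrn natrX.
  by rewrite gtr_pMr ?exprn_gt0.
(* Two distinct shifts in one node would be closer than [eps a], against [sep]. *)
have wjE : wj j = w.
  have jE2 : dfloor a (t2 + w) = j by rewrite -jE; apply: P2.
  have hw : has (fun w => dfloor a (t2 + w) == j%:Z) ws.
    by apply/hasP; exists w => //; rewrite jE2.
  apply/eqP; apply: contraT => /sep; rewrite mem_nth -?has_find// => /(_ isT ww).
  rewrite leNgt; have /eqP := nth_find 0 hw; rewrite -/(wj j) -jE2 => /dfloor_dist.
  by rewrite opprD addrACA subrr add0r => ->.
exists j; split=> //.
- have := P3 x j ltac:(lra) jlt; rewrite wjE.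
  rewrite (shift (top a) (x + w)) // (_ : x + w - M = (x - M) + w); last by ring.
  rewrite (P1 w (x - M) t1) //; [|lra|by rewrite lexx ltrDl].
  (* As [top a - base a = a + 1] is positive, the move changes the floor at [top a] by an even
     number. *)
  rewrite /top -addnA addKn addn1 -/(top a) exprS -mulrA addrAC => d.
  by apply: rpredD => //; exact: dvdz_mulr.
- rewrite (shift _ (x + w - _)) // [RHS]shift //; congr (_ + _).
  rewrite (_ : _ - _ - M = (x - M - eps (top a)) + w); last by ring.
  rewrite (_ : x + w - M = (x - M) + w); last by ring.
  by apply: P0 => //; lra.
Qed.

(* Adding [eps (top a)] flips the digit at [top a] while keeping all digits up
   to [base a], hence the code bit. *)
Lemma coded_clash a x y : coded a (x + eps (top a)) -> coded a y ->
  dfloor (top a) x = dfloor (top a) y -> False.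
Proof.
move=> [j [ja nj dj bj]] [i [ia ni di bi]] xy.
rewrite addrK in bj.
have coarse p := @dfloor_coarsen (base a) p _ _ ^~ bj.
have coarse' p := @dfloor_coarsen (top a) p _ _ ^~ xy.
have ab : (a <= base a)%N by rewrite /base; lia.
have bt : (base a <= top a)%N by rewrite /top; lia.
have ij : i = j.
  by apply/eqP; rewrite -eqz_nat -nj -ni -coarse// coarse'// (leq_trans ab).
subst i.
have jb : (2 * a + 2 * j.+1 <= base a)%N by rewrite /base; lia.
move: dj di; rewrite -(coarse (2 * a + _)%N)// coarse' ?(leq_trans jb)//.
rewrite dfloor_addeps xy; move: (dfloor _ _) (dfloor _ _) => k l; clear; lia.
Qed.

Lemma eps_cvg0 : eps n @[n --> \oo] --> (0 : R).
Proof.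
rewrite (_ : eps = GRing.exp 2^-1); last first.
  by apply/funext => n; rewrite /eps exprVn.
by apply: cvg_expr; rewrite ger0_norm// invf_lt1// ltr1n.
Qed.

(** * Null-finiteness of the reals coded at all levels *)

Section Sequence.
Variable lam : nat -> nat.
Hypothesis lamS : forall k, (top (lam k) + lam k + 3 <= lam k.+1)%N.

Definition coded_set : set R := [set y | forall k, coded (lam k) y].

Lemma lam_le i k : (i <= k)%N -> (lam i <= lam k)%N.
Proof.
elim: k => [|k IH]; first by rewrite leqn0 => /eqP->.
rewrite leq_eqVlt => /predU1P[->//|/IH]; have := lamS k; lia.
Qed.

Lemma top_lt_base i k : (i < k)%N -> (top (lam i) < base (lam k))%N.
Proof. by move=> /lam_le; have := lamS i; rewrite /base; lia. Qed.

(** For [i < k], adding [eps (top (lam k))] changes no digit of [x] up to [top (lam i)], so the two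
    memberships clash at level [lam i]. *)
Lemma coded_set_inj x i k :
  coded_set (x + eps (top (lam i))) -> coded_set (x + eps (top (lam k))) ->
  i = k.
Proof.
wlog ik : i k / (i < k)%N => [hw|].
  by move=> hi hk; have [/hw|/hw|//] := ltngtP i k; [|symmetry]; auto.
move=> /(_ i) hi hk.
have [j [_ _ _ bj]] := hk k; rewrite addrK in bj.
have [] := coded_clash hi (hk i).
by apply: dfloor_coarsen bj; apply/ltnW/top_lt_base.
Qed.

Hypothesis lam0 : (0 < lam 0)%N.

Lemma lam_gt k : (k < lam k)%N.
Proof. by elim: k => [//|k IH]; have := lamS k; lia. Qed.

Lemma coded_set_null_finite : null_finite coded_set.
Proof.
exists (fun k => eps (top (lam k))); split.
  exists 0; apply: (@squeeze_cvgr _ _ _ _ (cst 0) eps); last exact: eps_cvg0.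
    apply: nearW => k /=; rewrite ltW ?eps_gt0//= le_eps//.
    by have := lam_gt k; rewrite /top /base; lia.
  exact: cvg_cst.
move=> x; have [[i hi]|no] := pselect (exists n, coded_set (eps (top (lam n)) - x)).
  apply: (@sub_finite_set _ _ [set i]) => [k|]; last exact: finite_set1.
  rewrite /= addrC => hk; apply/esym/(@coded_set_inj (- x)) => //.
  by rewrite addrC.
rewrite (_ : [set _ | _] = set0); first exact: finite_set0.
by apply/seteqP; split=> // k hk; apply: no; exists k.
Qed.
End Sequence.
End Construction.

(** * Borel measurability *)

Section Borel.
Context {R : realType}.
Implicit Types (x y : R) (a : nat).

(** The borrow condition too depends only on the floor at [top a], which subtracting [eps (top a)]
    lowers by exactly 1. *)
Lemma coded_dfloor a x y :
  dfloor (top a) x = dfloor (top a) y -> coded a x -> coded a y.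
Proof.
move=> xy [j [ja nj dj bj]].
have coarse p := @dfloor_coarsen R (top a) p _ _ ^~ xy.
have ab : (a <= base a)%N by rewrite /base; lia.
have bt : (base a <= top a)%N by rewrite /top; lia.
have jb : (2 * a + 2 * j.+1 <= base a)%N by rewrite /base; lia.
exists j; split=> //; first by rewrite -coarse// (leq_trans ab).
  by rewrite -xy -coarse// (leq_trans jb).
rewrite -(coarse (base a))// -bj; apply: (@dfloor_coarsen _ (top a)) => //.
by apply: (addIr 1); rewrite -!dfloor_addeps !subrK.
Qed.

(** Hence the set is a countable union of half-open cells, each a difference of open rays. *)
Lemma borel_coded a : borel (coded a : set R).
Proof.
change ((@open R).-sigma.-measurable (coded a : set R)).
rewrite (_ : coded a = \bigcup_m [set x : R | dfloor (top a) x = m /\ coded a x]); last first.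
  apply/seteqP; split=> [x hx|x [m _ []]//].
  by exists (dfloor (top a) x).
apply: countable_bigcupT_measurable => // m.
have [[z [zm hz]]|no] := pselect (exists z : R, dfloor (top a) z = m /\ coded a z); last first.
  by rewrite (_ : [set _ | _] = set0)//; apply/seteqP; split=> // x hx; apply: no; exists x.
rewrite (_ : [set _ | _] = `]-oo, (m + 1)%:~R * eps (top a)[ `\`
                          `]-oo, m%:~R * eps (top a)[).
  by apply: measurableD; apply: sub_sigma_algebra; exact: interval_open.
apply/seteqP; split=> x /=.
  by rewrite !in_itv/= => -[/eqP]; rewrite dfloorP => /andP[ml ->]; rewrite ltNge ml.
rewrite !in_itv/= => -[mr /negP]; rewrite -leNgt => ml.
have xm : dfloor (top a) x = m by apply/eqP; rewrite dfloorP ml.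
by split=> //; apply: coded_dfloor hz; rewrite xm.
Qed.

Lemma borel_coded_set lam : borel (coded_set lam : set R).
Proof.
have B := fun k => borel_coded (lam k).
rewrite (_ : coded_set lam = \bigcap_k coded (lam k)); last first.
  by apply/seteqP; split=> [x hx k _|x hx k]; [exact: hx|exact: (hx k I)].
by apply: (@bigcap_measurableType _ (g_sigma_algebraType (@open R))) => k _; exact: B.
Qed.
End Borel.

(** * Points with many coded translates *)

Lemma dependent_choice_inv (S : Type) (Inv : nat -> S -> Prop)
    (Tr : nat -> S -> S -> Prop) (s0 : S) :
  Inv 0 s0 ->
  (forall k s, Inv k s -> exists s', Inv k.+1 s' /\ Tr k s s') ->
  exists f, f 0 = s0 /\ forall k, Inv k (f k) /\ Tr k (f k) (f k.+1).
Proof.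
move=> I0 step.
have next ks : exists s', Inv ks.1 ks.2 -> Inv ks.1.+1 s' /\ Tr ks.1 ks.2 s'.
  have [/step[s' h]|no] := pselect (Inv ks.1 ks.2); first by exists s'.
  by exists s0 => /no.
have [g gP] := choice next.
pose f := fix f k := if k is k'.+1 then g (k', f k') else s0.
have fI k : Inv k (f k) by elim: k => //= k /(gP (k, f k))[].
by exists f; split=> // k; split=> //; have [] := gP (k, f k) (fI k).
Qed.

Section Translates.
Context {R : realType}.
Variable lam : nat -> nat.
Hypothesis lam0 : (0 < lam 0)%N.
Hypothesis lamS : forall k, (top (lam k) + lam k + 3 <= lam k.+1)%N.
Variable W : nat -> R.

(* The shifts in [s.2] are those already separated from 0 at level [lam k]. The
   margin [delta k] around the next interval makes every later, smaller shift
   harmless at level [lam k]. *)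
Let delta k : R := eps (top (lam k) + lam k + 2).

Let in_range k (w : R) := 2 * eps (lam k.+1) <= `|w| <= delta k.

(** The size bound and [k < lam k] make [coded_translates] applicable; the bounds 1/4 and 3/4 keep
    all translates in [0, 1). *)
Let inv k (s : R * seq R) := [/\ (size s.2 <= k.+1)%N, 0 \in s.2,
  {in s.2 &, forall v w, v != w -> eps (lam k) <= `|v - w|},
  (forall w, w \in s.2 -> `|w| <= 4^-1) &
  4^-1 <= s.1 /\ s.1 + eps (lam k) <= 3 / 4].

Let trans k (s s' : R * seq R) := [/\
  (forall x, s'.1 - delta k <= x < s'.1 + eps (lam k.+1) + delta k ->
    s.1 <= x < s.1 + eps (lam k) /\ forall w, w \in s.2 -> coded (lam k) (x + w)),
  {subset s.2 <= s'.2} &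
  (exists n, in_range k (W n)) -> exists n, in_range k (W n) /\ W n \in s'.2].

Let delta_gt0 k : 0 < delta k. Proof. exact: eps_gt0. Qed.

(** The right side is [4 * delta k]; the next interval takes at most half a [delta k]. *)
Let eps_delta k : eps (lam k.+1) + 2 * delta k <= eps (top (lam k) + lam k).
Proof.
have := @le_eps R _ _ (lamS k); have := delta_gt0 k; rewrite /delta.
have := @epsS R (top (lam k) + lam k); have := @epsS R (top (lam k) + lam k).+1.
by rewrite !addnS addn0; have := @epsS R (top (lam k) + lam k).+2; lra.
Qed.

Let inv_step k s : inv k s -> exists s', inv k.+1 s' /\ trans k s s'.
Proof.
case: s => u ws [/= sk ws0 sep ws4 [ul ur]].
have lk := lam_gt lamS lam0 k.
have [||t [ut tu tP]] := @coded_translates R (lam k) u ws _ sep.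
- exact: leq_trans lk.
- by move=> x w hx /ws4; rewrite ler_norml; lra.
have d0 := delta_gt0 k; have ed := eps_delta k.
have le4 : delta k <= 4^-1.
  rewrite (_ : 4^-1 = eps 2); last by rewrite /eps -natrX.
  by rewrite le_eps// leq_addl.
have e0 : 0 < eps (lam k.+1) :> R := eps_gt0 _.
have ee : eps (lam k.+1) <= eps (lam k) :> R.
  by rewrite le_eps// (lam_le lamS).
have zone x : t + delta k - delta k <= x < t + delta k + eps (lam k.+1) + delta k ->
    u <= x < u + eps (lam k) /\ forall w, w \in ws -> coded (lam k) (x + w).
  by move=> hx; split=> [|w ww]; [lra|apply: tP => //; lra].
have sep' : {in ws &, forall v w, v != w -> eps (lam k.+1) <= `|v - w|}.
  by move=> v w hv hw /(sep _ _ hv hw); exact: le_trans.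
have [[n hn]|no] := pselect (exists n, in_range k (W n)); last first.
  exists (t + delta k, ws); split; split=> //=.
  - exact: leqW.
  - lra.
(* A nonzero [v] has size at least [eps (lam k)], of which [W n] can cancel at most half. *)
have far v : v \in ws -> eps (lam k.+1) <= `|v - W n|.
  move=> hv; have /andP[nl nr] := hn; have [->|v0] := eqVneq v 0.
    by rewrite sub0r normrN; lra.
  have := sep _ _ hv ws0 v0; rewrite subr0 => hv'.
  have := lerB_dist v (W n).
  have : 2 * delta k <= eps (lam k).
    by apply: lt_eps; rewrite -addnA ltn_addr// lt_top.
  have : 2 * eps (lam k.+1) <= eps (lam k) :> R.
    by apply: lt_eps; apply: leq_trans (lamS k); rewrite -addnA ltn_addr// lt_top.
  lra.
exists (t + delta k, W n :: ws); split; split=> //=.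
- by rewrite inE ws0 orbT.
- move=> v w; rewrite !inE => /predU1P[->|hv] /predU1P[->|hw].
  + by rewrite eqxx.
  + by move=> _; rewrite distrC far.
  + by move=> _; rewrite far.
  + exact: sep'.
- move=> w; rewrite inE => /predU1P[->|/ws4//].
  by have /andP[_ /le_trans] := hn; apply.
- lra.
- by move=> w hw; rewrite inE hw orbT.
- by move=> _; exists n; rewrite inE eqxx.
Qed.

(** The point is common to all the nested intervals. A shift added at step [k] is within the margins
    of the levels up to [lam k] and is listed at all later ones. *)
Lemma coded_set_translate : exists x, coded_set lam x /\
  forall k, (exists n, in_range k (W n)) ->
    exists n, in_range k (W n) /\ coded_set lam (x + W n).
Proof.
have inv0 : inv 0 (4^-1, [:: 0]).
  split=> //=.
  - exact: mem_head.
  - by move=> v w; rewrite !inE => /eqP-> /eqP->; rewrite eqxx.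
  - by move=> w; rewrite inE => /eqP->; rewrite normr0 invr_ge0.
  - have := @le_eps R _ _ lam0; rewrite (_ : eps 1 = 2^-1); last by rewrite /eps expr1.
    by lra.
have [f [_ fP]] := dependent_choice_inv inv0 inv_step.
pose u k := (f k).1.
have zone k x : u k.+1 - delta k <= x < u k.+1 + eps (lam k.+1) + delta k ->
    u k <= x < u k + eps (lam k) /\
    forall w, w \in (f k).2 -> coded (lam k) (x + w).
  by have [_ [h _ _]] := fP k; exact: h.
have ulS k : u k <= u k.+1.
  have [|/andP[]//] := zone k (u k.+1).
  by have := delta_gt0 k; have := @eps_gt0 R (lam k.+1); lra.
have urS k : u k.+1 + eps (lam k.+1) < u k + eps (lam k).
  have [|/andP[]//] := zone k (u k.+1 + eps (lam k.+1)).
  by have := delta_gt0 k; have := @eps_gt0 R (lam k.+1); lra.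
have ul i k : (i <= k)%N -> u i <= u k.
  by elim: k => [|k IH]; [rewrite leqn0 => /eqP->|
    rewrite leq_eqVlt => /predU1P[->//|/IH/le_trans]; apply].
have ur i k : (i <= k)%N -> u k + eps (lam k) <= u i + eps (lam i).
  elim: k => [|k IH]; first by rewrite leqn0 => /eqP->.
  by rewrite leq_eqVlt => /predU1P[->//|/IH]; apply/le_trans/ltW.
have ulr i k : u i <= u k + eps (lam k).
  have := ul _ _ (leq_maxl i k); have := ur _ _ (leq_maxr i k).
  by have := @eps_gt0 R (lam (maxn i k)); lra.
pose x := sup (range u).
have xl k : u k <= x.
  by apply: ub_le_sup; [exists (u 0 + eps (lam 0)) => _ [i _ <-]|exists k].
(* The right ends decrease strictly, so the supremum stays in the half-open intervals. *)
have xr k : x < u k + eps (lam k).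
  apply: le_lt_trans (urS k); apply: ge_sup; first by exists (u 0), 0.
  by move=> _ [i _ <-].
have f0 k : 0 \in (f k).2 by have [[]] := fP k.
have small k w : `|w| <= delta k -> coded (lam k) (x + w).
  rewrite ler_norml => hw; have [|_ /(_ 0 (f0 k))] := zone k (x + w).
    by have := xl k.+1; have := xr k.+1; lra.
  by rewrite addr0.
exists x; split=> [k|k]; first by rewrite -[x]addr0; apply: small; rewrite normr0 ltW.
have [_ [_ _ h]] := fP k; move=> /h[n [hn Wn]]; exists n; split=> // i.
have [ki|ik] := ltnP k i.
  have Wi : W n \in (f i).2.
    elim: i ki => // i IH; rewrite ltnS leq_eqVlt => /predU1P[<-//|/IH].
    by have [_ [_ sub _]] := fP i; exact: sub.
  have [|_] := zone i x; last exact.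
  by have := xl i.+1; have := xr i.+1; have := delta_gt0 i; lra.
apply: small; have /andP[_ /le_trans] := hn; apply.
by rewrite le_eps// leq_add2r leq_add ?leq_top ?(lam_le lamS).
Qed.
End Translates.

(** * The union over even and odd levels *)

Fixpoint level i : nat :=
  if i is j.+1 then top (level j) + level j + 3 else 1.

Definition sublevel (e k : nat) : nat := level (2 * k + e).

Lemma sublevel0 e : (0 < sublevel e 0)%N.
Proof. by rewrite /sublevel; case: (2 * 0 + e)%N => //= n; rewrite addn3. Qed.

Lemma sublevelS e k :
  (top (sublevel e k) + sublevel e k + 3 <= sublevel e k.+1)%N.
Proof.
rewrite /sublevel (_ : 2 * k.+1 + e = (2 * k + e).+2)%N; last by lia.
by move: (2 * k + e)%N => j; rewrite [level j.+2]/= -/(level j.+1); lia.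
Qed.

Lemma leq_level i k : (i <= k)%N -> (level i <= level k)%N.
Proof. by apply: (@lam_le level) => j; exact: leqnn. Qed.

Lemma level_gt i : (i < level i)%N.
Proof. by elim: i => //= i IH; lia. Qed.

Section Main.
Context {R : realType}.

Lemma eps_level_small (d : R) : 0 < d -> exists i, 2 * eps (level i.+1) < d.
Proof.
move=> d0; have /cvgrPdist_lt /(_ _ d0) [i _ /(_ i (leqnn i))] := @eps_cvg0 R.
rewrite sub0r normrN ger0_norm ?ltW ?eps_gt0// => id; exists i.
apply: le_lt_trans id; apply: lt_eps; exact: ltnW (level_gt _).
Qed.

(** Consecutive ranges share an endpoint. The least [i] whose lower end is below [r] works: the
    upper bound is minimality, or the hypothesis if [i = m]. *)
Lemma level_range (m : nat) (r : R) : 0 < r <= 2 * eps (level m.+1) ->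
  exists i, (m <= i)%N /\ 2 * eps (level i.+2) <= r <= 2 * eps (level i.+1).
Proof.
move=> /andP[r0 rm].
have exj : exists j, (m <= j)%N && (2 * eps (level j.+2) <= r).
  have [i ir] := eps_level_small r0; exists (maxn m i).
  rewrite leq_maxl andTb (le_trans _ (ltW ir))// ler_pM2l// le_eps//.
  by apply: leq_level; lia.
have [i /andP[mi ir] imin] := ex_minnP exj; exists i; split=> //.
rewrite ir andTb; case: i mi ir imin => [|i] mi ir imin.
  by move: mi rm; rewrite leqn0 => /eqP ->.
have [<-//|mi'] := eqVneq m i.+1.
rewrite leNgt; apply/negP => /ltW lt.
have := imin i; rewrite lt andbT ltnn => ni.
by have := ni _; rewrite -ltnS ltn_neqAle mi' mi => /(_ isT).
Qed.

Lemma nonzero_lower_bound (W : nat -> R) N :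
  exists2 d, 0 < d & forall n, (n < N)%N -> W n != 0 -> d <= `|W n|.
Proof.
elim: N => [|N [d d0 IH]]; first by exists 1.
have [W0|W0] := eqVneq (W N) 0.
  exists d => // n; rewrite ltnS leq_eqVlt => /predU1P[->|/IH//].
  by rewrite W0 eqxx.
exists (Num.min d `|W N|); first by rewrite lt_min d0 normr_gt0.
move=> n; rewrite ltnS leq_eqVlt ge_min => /predU1P[->|/IH h /h ->//].
by rewrite lexx orbT.
Qed.

Lemma finite_set_ltn (D : set nat) : finite_set D ->
  exists N, forall n, D n -> (n < N)%N.
Proof.
move=> /finite_seqP[s ->]; exists (\max_(i <- s) i).+1 => n /= ns.
by rewrite ltnS; apply: leq_bigmax_seq.
Qed.

Lemma coded_union_not_null_finite :
  ~ null_finite (coded_set (sublevel 0) `|` coded_set (sublevel 1) : set R).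
Proof.
set C := _ `|` _; move=> [v [[l vl] fin]]; pose W n := v n - l.
have T e := coded_set_translate (sublevel0 e) (sublevelS e) W.
have [[x0 [Cx0 T0]] [x1 [Cx1 T1]]] := (T 0, T 1).
have vW n x : C (x + W n) -> C (v n - (l - x)).
  by rewrite opprB addrCA addrA addrC.
have [N hN] : exists N, forall n, C (x0 + W n) \/ C (x1 + W n) -> (n < N)%N.
  have [N0 h0] := finite_set_ltn (fin (l - x0)).
  have [N1 h1] := finite_set_ltn (fin (l - x1)).
  by exists (maxn N0 N1) => n [/vW/h0|/vW/h1] nN; rewrite leq_max nN ?orbT.
have [d d0 hd] := nonzero_lower_bound W N.
have [m md] := eps_level_small d0.
have eta0 : 0 < 2 * eps (level m.+1) :> R by rewrite mulr_gt0// eps_gt0.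
have /cvgrPdist_le /(_ _ eta0) [N' _ hN'] := vl.
pose n := maxn N N'.
have Wn : `|W n| <= 2 * eps (level m.+1).
  by rewrite distrC; apply: hN'; exact: leq_maxr.
(* Otherwise [x0] itself, a point of [C], would be hit at an index not below [N]. *)
have Wn0 : W n != 0.
  apply/negP => /eqP Wn0; have := hN n; rewrite Wn0 addr0 ltnNge leq_maxl.
  by move=> /(_ (or_introl (or_introl Cx0))).
have [|i [mi ir]] := @level_range m `|W n|; first by rewrite normr_gt0 Wn0.
have range_small n' : 2 * eps (level i.+2) <= `|W n'| <= 2 * eps (level i.+1) ->
    ~ (n' < N)%N.
  move=> /andP[lo hi] /hd; rewrite -normr_gt0 (lt_le_trans _ lo) ?mulr_gt0 ?eps_gt0//.
  move=> /(_ isT); rewrite leNgt (le_lt_trans hi)// (le_lt_trans _ md)//.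
  rewrite ler_pM2l// le_eps//.
  by apply: leq_level; lia.
(* The recursion for [level] makes the upper end of [in_range] exactly that of [level_range]. *)
have rE : eps (top (level i) + level i + 2) = 2 * eps (level i.+1) :> R.
  by rewrite epsS /= addn3 addn2.
have iE := odd_double_half i.
have [oi|ei] := boolP (odd i).
- have ki : (2 * i./2 + 1 = i)%N by rewrite -[RHS]iE oi; lia.
  have ki2 : (2 * i./2.+1 + 1 = i.+2)%N by lia.
  have := T1 i./2; rewrite /sublevel ki ki2 rE => -[|n' [hn' Cn']]; first by exists n.
  by apply: (range_small n' hn'); apply: hN; right; right.
- have ki : (2 * i./2 + 0 = i)%N by rewrite -[RHS]iE (negbTE ei); lia.
  have ki2 : (2 * i./2.+1 + 0 = i.+2)%N by lia.
  have := T0 i./2; rewrite /sublevel ki ki2 rE => -[|n' [hn' Cn']]; first by exists n.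
  by apply: (range_small n' hn'); apply: hN; left; left.
Qed.

Lemma not_fin_bigcup_closed : ~ fin_bigcup_closed (@borel_null_finite R).
Proof.
move=> H; apply: coded_union_not_null_finite; rewrite -bigcup2inE.
have NF e : borel_null_finite (coded_set (sublevel e) : set R).
  split; first exact: borel_coded_set.
  exact: coded_set_null_finite (sublevelS e) (sublevel0 e).
have [|[|[|//]] _|//] := H nat `I_2
  (bigcup2 (coded_set (sublevel 0)) (coded_set (sublevel 1))).
- exact: finite_II.
- exact: NF.
- exact: NF.
Qed.
End Main.

Theorem corollary6p2 (R : realType) :
  ~ is_ideal (@borel_null_finite R) /\
  ~ is_ideal_of (@borel R) (@borel_null_finite R).
Proof.
by split=> [[_]|[_ _]]; exact: not_fin_bigcup_closed.
Qed.
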